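(* Let $G=(V(G),E(G))$ be a finite simple connected graph with vertex set $V(G)=\{x_1,\ldots,x_n\}$, let $K$ be a field, $R=K[x_1,\ldots,x_n]$, and let $J(G)=\bigcap_{\{x_i,x_j\}\in E(G)}(x_i,x_j)\subset R$ be the cover ideal of $G$. Then $J(G)$ has the nearly copersistence property if and only if $G$ is either a bipartite graph or an almost bipartite graph.
   Context: A monomial ideal $I$ in a polynomial ring $R=K[x_1,\ldots,x_n]$ over a field $K$ has the nearly copersistence property if there exist a positive integer $s$ and a monomial prime ideal $\mathfrak{p}$ of $R$ such that $\mathrm{Ass}_R(R/I^m)\cup\{\mathfrak{p}\}\supseteq \mathrm{Ass}_R(R/I^{m+1})$ for all $1\le m\le s$, and $\mathrm{Ass}_R(R/I^m)\supseteq\mathrm{Ass}_R(R/I^{m+1})$ for all $m\ge s+1$. A finite simple connected graph is called almost bipartite if it has exactly one induced subgraph that is an odd cycle. *)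

(* Defs.v *)
From HB Require Import structures.
From mathcomp Require Import all_boot all_order all_algebra.
From mathcomp Require Import mpoly.

Set Implicit Arguments.
Unset Strict Implicit.
Unset Printing Implicit Defensive.

Import GRing.Theory.
Local Open Scope ring_scope.

Section Ideals.
Variables (K : fieldType) (n : nat).
Notation R := {mpoly K[n]}.

Definition polyset := R -> Prop.

Definition ideal_gen (S : polyset) : polyset := fun p =>
  exists (gs cs : seq R), size cs = size gs /\ (forall g, g \in gs -> S g) /\
    p = \sum_(i < size gs) cs`_i * gs`_i.

Definition is_ideal (I : polyset) : Prop :=
  I 0 /\ (forall a b, I a -> I b -> I (a + b)) /\ (forall r a, I a -> I (r * a)).

Definition prime_ideal (P : polyset) : Prop :=
  is_ideal P /\ ~ P 1 /\ (forall a b, P (a * b) -> P a \/ P b).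

Definition ideal_pow (I : polyset) (m : nat) : polyset :=
  ideal_gen (fun p => exists s : seq R, size s = m /\ (forall g, g \in s -> I g) /\
                                        p = \prod_(g <- s) g).

Definition Ass (I : polyset) (P : polyset) : Prop :=
  prime_ideal P /\ exists f : R, forall g, P g <-> I (g * f).

Definition monomial_prime (P : polyset) : Prop :=
  prime_ideal P /\
  exists A : {set 'I_n}, forall g,
    P g <-> ideal_gen (fun h => exists2 i, i \in A & h = 'X_i) g.

Definition nearly_copersistent (I : polyset) : Prop :=
  exists (s : nat) (P : polyset), (0 < s)%N /\ monomial_prime P /\
    (forall m, (1 <= m <= s)%N -> forall Q, Ass (ideal_pow I m.+1) Q ->
        Ass (ideal_pow I m) Q \/ (forall g, Q g <-> P g)) /\
    (forall m, (s.+1 <= m)%N -> forall Q, Ass (ideal_pow I m.+1) Q ->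
        Ass (ideal_pow I m) Q).

Definition cover_ideal (e : rel 'I_n) : polyset := fun f =>
  forall i j, e i j -> ideal_gen (fun h => h = 'X_i \/ h = 'X_j) f.

End Ideals.

Section Graphs.
Variable n : nat.

Definition simple_graph (e : rel 'I_n) : Prop :=
  irreflexive e /\ ssrbool.symmetric e.

Definition connected_graph (e : rel 'I_n) : Prop :=
  forall x y, connect e x y.

Definition bipartite (e : rel 'I_n) : Prop :=
  exists c : 'I_n -> bool, forall x y, e x y -> c x != c y.

Definition induced_odd_cycle (e : rel 'I_n) (S : {set 'I_n}) : Prop :=
  odd #|S| /\ (3 <= #|S|)%N /\
  exists s : seq 'I_n, uniq s /\ (forall x, (x \in S) = (x \in s)) /\
    forall x y, x \in S -> y \in S ->
      (e x y <-> (y == next s x) || (x == next s y)).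

Definition almost_bipartite (e : rel 'I_n) : Prop :=
  exists! S : {set 'I_n}, induced_odd_cycle e S.

End Graphs.

(* Main.v *)
Require Import Defs.
From HB Require Import structures.
From mathcomp Require Import all_boot all_order all_algebra.
From mathcomp Require Import mpoly.
From mathcomp Require Import zify ring.
From Stdlib Require Import Classical.

(** Write P_A for the prime generated by the variables in A.  Every element of
   the cover ideal J has order at least d_A = ceil(|A|/2) in the variables of A
   when A is an edge or an induced odd cycle, so J^m lies in P_A^(m d_A); a
   monomial of A-order m d_A - 1 that every variable of A multiplies into J^m
   then shows that P_A is associated to J^m.  Such monomials exist for edges
   (m >= 1) and for induced odd cycles (m >= 2), whereas only edges give
   associated primes of J.  Hence two distinct induced odd cycles contradict
   nearly copersistence at m = 1.

   Conversely, if some vertex v lies on all induced odd cycles, then J^m is the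
   intersection of the ideals P_A^(m d_A), which are P_A-primary, so no other
   prime is associated to J^m.  On monomials x^a this says that a dominates a
   sum of m vertex covers as soon as it satisfies the edge and odd cycle
   inequalities.  Taking complements, vertices must receive m - a_i out of m
   colours, adjacent vertices getting disjoint sets.  The colours are split into
   those of v and the rest; as the graph without v is bipartite, it suffices to
   decide how many colours of each vertex go to each of the two parts, which is a
   system of difference constraints solved by shortest walks from v. *)

Set Implicit Arguments.
Unset Strict Implicit.
Unset Printing Implicit Defensive.

(** * Odd closed walks *)

Section OddWalks.
Variable n : nat.
Implicit Types (e : rel 'I_n) (s p q : seq 'I_n) (b : 'I_n -> nat) (m : nat).

Lemma even_walk_sum e b m p :
  (forall x y, e x y -> b x + b y <= m) ->
  sorted e p -> ~~ odd (size p) -> 2 * \sum_(x <- p) b x <= m * size p.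
Proof.
move=> eb; have [k] := ubnP (size p); elim: k p => // k IHk [|x [|y p]] //= le_k.
  by rewrite big_nil.
move=> /andP[exy pathp]; rewrite negbK => evp.
have sp : sorted e p by move: pathp; case: (p) => //= z r /andP[].
have := IHk p; rewrite !big_cons => /(_ ltac:(lia) sp evp).
have := eb _ _ exy; lia.
Qed.

Lemma not_uniq_split s : ~~ uniq s ->
  exists s1 x s2 s3, s = s1 ++ x :: s2 ++ x :: s3.
Proof.
elim: s => //= x s IHs; rewrite negb_and negbK => /orP[/splitPr[p q] | /IHs].
  by exists [::], x, p, q.
by move=> [s1 [y [s2 [s3 ->]]]]; exists (x :: s1), y, s2, s3.
Qed.

(** With [x] rotated to the front, [p] or [q] being empty means that [y] is cyclically adjacent to
    [x], so the hypothesis excludes repeated vertices and chords at once. *)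
Lemma chordless_odd_cycle e s :
  irreflexive e -> ssrbool.symmetric e -> cycle e s -> odd (size s) ->
  (forall k x p y q, rot k s = x :: p ++ y :: q ->
     x <> y /\ (e x y -> p = [::] \/ q = [::])) ->
  uniq s /\ induced_odd_cycle e [set x in s].
Proof.
move=> irr sym cyc odds nochord.
have us : uniq s.
  apply: contraT => /not_uniq_split[s1 [x [s2 [s3 def_s]]]].
  have [] // := nochord (size s1) x s2 x (s3 ++ s1).
  by rewrite def_s rot_size_cat /= -catA.
split=> //; split; first by rewrite cardsE (card_uniqP us).
split.
  rewrite cardsE (card_uniqP us).
  by case: s odds cyc {us nochord} => [|x [|y []]] //=; rewrite irr.
exists s; split=> //; split=> [x|x y]; first by rewrite inE.
rewrite !inE => xs ys; split; last first.
  by case/orP=> /eqP->; rewrite 1?[e _ y]sym; apply: next_cycle.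
move=> exy; have [k s' def_s] := rot_to xs.
have xNy : x != y by apply: contraTneq exy => ->; rewrite irr.
have : y \in s' by move: ys; rewrite -(mem_rot k) def_s inE eq_sym (negPf xNy).
rewrite -!(next_rot k us) def_s; move: def_s us.
rewrite -(rot_uniq k) => + + /splitPr def_s'; case: def_s' => p q def_s; rewrite def_s.
have [_ /(_ exy)[->|->]] := nochord _ _ _ _ _ def_s => us.
  by rewrite /= eqxx eqxx.
(* Here [y] comes last, so its index runs past the tail and [nth] returns its default, the head
   [x]. *)
apply/orP; right; rewrite next_nth cats1 inE mem_rcons inE eqxx orbT /=.
rewrite (negPf xNy) nth_default // -cats1 index_cat /=.
have /negPf-> : y \notin p by move: us; rewrite /= cats1 rcons_uniq => /and3P[].
by rewrite eqxx size_cat addn0 addn1.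
Qed.

(* A closed odd walk which is not an induced cycle splits along a repeated
   vertex or a chord into a shorter odd closed walk and an even open walk. *)
Lemma odd_walk_sum e b m s :
  irreflexive e -> ssrbool.symmetric e ->
  (forall x y, e x y -> b x + b y <= m) ->
  (forall s, uniq s -> cycle e s -> induced_odd_cycle e [set x in s] ->
     2 * (\sum_(x <- s) b x) + m <= m * size s) ->
  cycle e s -> odd (size s) -> 2 * (\sum_(x <- s) b x) + m <= m * size s.
Proof.
move=> irr sym eb indb.
have [k] := ubnP (size s); elim: k s => // k IHk s le_k cyc odds.
case: (classic (exists k x p y q, rot k s = x :: p ++ y :: q /\
     (x = y \/ [/\ e x y, p <> [::] & q <> [::]]))); last first.
  move=> nochord; have [] := @chordless_odd_cycle e s => //; last by auto.
  move=> l x p y q def_s; split=> [xy|exy].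
    by apply: nochord; exists l, x, p, y, q; split=> //; left.
  apply: NNPP => /not_or_and[p0 q0].
  by apply: nochord; exists l, x, p, y, q; split=> //; right.
move=> [l [x [p [y [q [def_s chord]]]]]].
rewrite -(size_rot l) -(perm_big _ (introT permPl (perm_rot l s))) /=.
rewrite -(rot_cycle l) -(size_rot l) def_s in cyc odds le_k *.
rewrite big_cons big_cat big_cons /= size_cat /=.
move: cyc; rewrite /= rcons_cat rcons_cons cat_path /= => /and3P[xp py yq].
move: odds le_k; rewrite /= size_cat /= addnS oddS oddD => odds le_k.
have sq r z : path e z (rcons r x) -> sorted e r.
  by rewrite -cats1 cat_path => /andP[/path_sorted].
have sy : sorted e (y :: q) by move: yq; rewrite /= -cats1 cat_path => /andP[].
case: chord => [eq_xy | [exy p0 q0]].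
  subst y; case: (boolP (odd (size p))) => [oddp | evp].
    have := IHk (x :: q); have := even_walk_sum eb (p := x :: p) xp.
    rewrite /= yq !big_cons /=; lia.
  have := IHk (x :: p); have := even_walk_sum eb (p := x :: q) sy.
  rewrite /= rcons_path xp py !big_cons /=; lia.
case: (boolP (odd (size p))) => [oddp | evp].
  have := IHk (x :: rcons p y); have := even_walk_sum eb (sq _ _ yq).
  have : 0 < size q by case: (q) q0.
  rewrite /= !rcons_path last_rcons xp py sym exy -cats1 !big_cons big_cat.
  rewrite big_seq1 /= size_cat /=; lia.
have := IHk (y :: rcons q x); have := even_walk_sum eb (path_sorted xp).
have : 0 < size p by case: (p) p0.
rewrite /= rcons_path last_rcons yq exy -cats1 !big_cons big_cat.
rewrite big_seq1 /= size_cat /=; lia.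
Qed.

(** For unit weights and [m = 2] the bound of [odd_walk_sum] fails on every odd closed walk, while
    without induced odd cycles its hypothesis on cycles would be vacuous. *)
Lemma odd_walk_induced e s :
  irreflexive e -> ssrbool.symmetric e -> cycle e s -> odd (size s) ->
  exists S, induced_odd_cycle e S.
Proof.
move=> irr sym cyc odds; apply: NNPP => noS.
have := @odd_walk_sum e (fun=> 1) 2 s irr sym (fun _ _ _ => isT) _ cyc odds.
rewrite sum1_size => /(_ _)/wrap[t _ _ indt|]; last by lia.
by case: noS; exists [set x in t].
Qed.

Lemma bipartite_even_cycle e s : bipartite e -> cycle e s -> ~~ odd (size s).
Proof.
move=> [c ec]; have pathc p x : path e x p -> c (last x p) = c x (+) odd (size p).
  elim: p x => [|y p IHp] x /=; first by rewrite addbF.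
  by move=> /andP[/ec + /IHp ->]; case: (c x) (c y) (odd _) => [] [] [].
case: s => //= x s /pathc; rewrite last_rcons size_rcons /=.
by case: (c x) (odd _) => [] [].
Qed.

Lemma bipartite_no_induced_odd_cycle e S : bipartite e -> ~ induced_odd_cycle e S.
Proof.
move=> bip [oddS [_ [t [ut [St et]]]]].
have /(bipartite_even_cycle bip) : cycle e t.
  apply: cycle_from_next => // x xt.
  by apply/et; rewrite ?St ?mem_next ?eqxx.
by rewrite -(card_uniqP ut) -(eq_card St) oddS.
Qed.

(** A vertex is coloured by the parity of a chosen walk from the root of its component; an edge
    between equal colours would close an odd walk through the root. *)
Lemma even_cycles_bipartite e :
  ssrbool.symmetric e -> (forall s, cycle e s -> ~~ odd (size s)) -> bipartite e.
Proof.
move=> sym evc; have csym := sym_connect_sym sym.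
have /fin_all_exists[w wP] x : exists p,
    path e (fingraph.root e x) p /\ x = last (fingraph.root e x) p.
  have /connectP[p ? ?] : connect e (fingraph.root e x) x.
    by rewrite csym connect_root.
  by exists p.
have closed r p : path e r p -> last r p = r -> ~~ odd (size p).
  case: (lastP p) => [//|q z]; rewrite last_rcons => + eq_zr; rewrite {z}eq_zr => cyc.
  by rewrite size_rcons; apply: evc (r :: q) cyc.
exists (fun x => odd (size (w x))) => x y exy.
have [pathx lastx] := wP x; have [pathy lasty] := wP y.
have eqr : fingraph.root e y = fingraph.root e x.
  by apply/esym/(fingraph.rootP csym)/connect1.
rewrite eqr in pathy lasty.
have := closed (fingraph.root e x) (w x ++ y :: rev (belast (fingraph.root e x) (w y))).
rewrite cat_path -lastx pathx /= exy last_cat /= size_cat /= size_rev size_belast.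
rewrite {1}lasty rev_path (eq_path (e' := e)) => [|? ?]; last by rewrite sym.
rewrite pathy addnS oddS oddD => /(_ isT).
case: (w y) lasty => [|z q] -> /=; last rewrite rev_cons last_rcons.
  by move=> /(_ erefl); case: (odd _).
by move=> /(_ erefl); case: (odd _) (odd _) => [] [].
Qed.

End OddWalks.

(** * Packing vertex covers *)

Section Packing.
Variable n : nat.
Implicit Types (e : rel 'I_n) (s p q : seq 'I_n) (b : 'I_n -> nat) (m : nat).

Lemma ex_least (lo hi : nat) (K : nat -> Prop) : lo <= hi ->
  exists t, [/\ lo <= t <= hi, t = hi \/ K t & forall u, lo <= u -> K u -> t <= u].
Proof.
have [k] := ubnP (hi - lo); elim: k lo => // k IHk lo le_k le_lh.
case: (classic (lo = hi \/ K lo)) => [Klo | /not_or_and[/eqP lo_hi nK]].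
  by exists lo; rewrite leqnn le_lh; split.
have [|//|t [t_in Kt min_t]] := IHk lo.+1; [lia | by rewrite ltn_neqAle lo_hi |].
exists t; split=> [|//|u]; first lia.
rewrite leq_eqVlt => /orP[/eqP<- /nK// | lo_u Ku]; exact: min_t.
Qed.

Lemma ex_greatest (lo hi : nat) (K : nat -> Prop) : lo <= hi ->
  exists t, [/\ lo <= t <= hi, t = lo \/ K t & forall u, u <= hi -> K u -> u <= t].
Proof.
move=> le_lh.
have [//|t [t_in Kt min_t]] := @ex_least 0 (hi - lo) (fun t => K (hi - t)) _.
exists (hi - t); split=> [||u le_u Ku]; [lia | | ].
  by case: Kt => [->|]; [left; lia | right].
have := min_t (hi - u) (leq0n _); rewrite subKn // => /(_ Ku); lia.
Qed.

(* [x i] is the number of colours of [i] shared with [v].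
   The constraints on [x] form a system of difference constraints on the
   bipartite graph [e - v] (negate [x] on one side), solved by shortest walk
   lengths from [v]; odd closed walks through [v] are the only possible
   negative cycles. *)
Lemma split_weights e v (L : 'I_n -> bool) b m :
  irreflexive e -> ssrbool.symmetric e ->
  (forall x y, e x y -> x <> v -> y <> v -> L x != L y) ->
  (forall i, b i <= m) -> (forall i j, e i j -> b i + b j <= m) ->
  (forall s, cycle e s -> odd (size s) ->
     2 * (\sum_(x <- s) b x) + m <= m * size s) ->
  exists x : 'I_n -> nat,
    [/\ forall i, [&& x i <= b i, x i <= b v & b i + b v <= m + x i],
        forall i, e v i -> x i = 0
      & forall i j, i <> v -> j <> v -> e i j ->
          x i + x j <= b v /\ b i + b j + b v <= m + x i + x j].
Proof.
move=> irr sym eL bm eb oddb.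
(* Sets of [b i] and [b v] colours out of [m] share at least [lo i] and at most [hi i] colours;
   truncated subtraction makes [lo i] zero when they can be disjoint. *)
pose lo i := b i + b v - m; pose hi i := minn (b i) (b v).
have lohi i j : e i j -> lo i + hi j <= b v /\ b i + b j + b v <= m + lo i + hi j.
  by move=> /eb; have := bm i; have := bm j; have := bm v; rewrite /lo /hi; lia.
pose walk q i := [/\ path e v q, v \notin q & last v q = i].
(* Each walk from [v] propagates the constraints: [t] is at least some resulting upper bound in
   [KL], and at most some resulting lower bound in [KR]. Both are doubled to avoid halves. *)
pose KL i t := exists q, [/\ walk q i, odd (size q) &
  m * (size q).-1 + 2 * b i <= 2 * t + 2 * \sum_(x <- q) b x].
pose KR i t := exists q, [/\ walk q i, ~~ odd (size q) &
  m * size q + 2 * t <= 2 * b v + 2 * \sum_(x <- q) b x].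
have walkS q i j : walk q i -> e i j -> j <> v -> walk (rcons q j) j.
  move=> [pq vq lq] eij /eqP jv.
  by rewrite /walk rcons_path pq lq last_rcons mem_rcons inE negb_or eq_sym jv.
have /fin_all_exists[x xP] i : exists t, [/\ lo i <= t <= hi i,
    L i -> (t = hi i \/ KL i t) /\ forall u, lo i <= u -> KL i u -> t <= u
  & ~~ L i -> (t = lo i \/ KR i t) /\ forall u, u <= hi i -> KR i u -> u <= t].
  have le_lh : lo i <= hi i by have := bm i; have := bm v; rewrite /lo /hi; lia.
  case: (boolP (L i)) => _.
    by have [t []] := ex_least (KL i) le_lh; exists t.
  by have [t []] := ex_greatest (KR i) le_lh; exists t.
have xlohi i : lo i <= x i <= hi i by have [] := xP i.
have edge i j : L i -> ~~ L j -> i <> v -> j <> v -> e i j ->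
    x i + x j <= b v /\ b i + b j + b v <= m + x i + x j.
  move=> Li Rj iv jv eij; have [_ /(_ Li)[Ki mini] _] := xP i.
  have [_ _ /(_ Rj)[Kj maxj]] := xP j.
  have := xlohi i; have := xlohi j; have := lohi i j eij.
  have := lohi j i ltac:(by rewrite sym); have := eb _ _ eij.
  have := bm i; have := bm j; rewrite /lo /hi; split.
    (* The walk realising the value at one end of the edge extends to the other end, where
       extremality gives the inequality. *)
    case: Kj => [->|[q [wq evq sumq]]]; first by rewrite /lo; lia.
    case: (leqP (lo i) (b v - x j)) => [le_lo|]; last by rewrite /lo; lia.
    suff : x i <= b v - x j by lia.
    apply: (mini _ le_lo); exists (rcons q i); split.
    - by apply: walkS wq _ iv; rewrite sym.
    - by rewrite size_rcons.
    by rewrite size_rcons -cats1 big_cat big_seq1 /=; lia.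
  case: Ki => [->|[q [wq evq sumq]]]; first by rewrite /hi; lia.
  case: (leqP (b i + b j + b v) (m + x i)) => [|gt_m]; first lia.
  pose t := minn (hi j) (b v + b j + b i - x i - m).
  suff : t <= x j by rewrite /t /hi; lia.
  apply: maxj; first by rewrite /t; lia.
  exists (rcons q j); split; first exact: walkS wq eij jv.
    by rewrite size_rcons /= negbK.
  rewrite size_rcons -cats1 big_cat big_seq1 /= /t.
  have : 0 < size q by case: (q) evq.
  lia.
exists x; split=> [i | i evi | i j iv jv eij].
- by have := xlohi i; have := bm i; have := bm v; rewrite /lo /hi; lia.
- have iv : i <> v by move=> iv; rewrite iv irr in evi.
  have vi : v != i by apply/eqP => /esym.
  have lo0 : lo i = 0 by have := eb _ _ evi; rewrite /lo; lia.
  have [_ HL HR] := xP i; case: (boolP (L i)) => [/HL | /HR] [Ki ext].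
    apply/eqP; rewrite -leqn0; apply: ext; first by rewrite lo0.
    exists [:: i]; split=> //; first by rewrite /walk /= evi inE.
    by rewrite /= big_seq1; lia.
  (* A walk realising [x i] closes up at [v] to an odd closed walk, and [oddb] leaves only the value
     0. *)
  case: Ki => [->//|[q [[pq vq lq] evq sumq]]].
  have := oddb (v :: q); rewrite /= rcons_path pq lq sym evi big_cons => /(_ isT evq).
  by lia.
have := eL _ _ eij iv jv; case: (boolP (L i)) (boolP (L j)) => [Li|Ri] [Lj|Rj] // _.
  exact: edge.
by rewrite sym in eij; have [] := edge j i Lj Ri jv iv eij; split; lia.
Qed.

Lemma sum_interval lo len m : lo + len <= m ->
  \sum_(t <- iota 0 m) (lo <= t < lo + len : nat) = len.
Proof.
move=> le_m; rewrite -big_mkcond /= sum1_count.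
rewrite -(subnKC le_m) -addnA !iotaD !count_cat add0n !addnA.
rewrite (eq_in_count (a2 := pred0)) ?count_pred0; last first.
  by move=> t; rewrite mem_iota /=; lia.
rewrite (eq_in_count (a2 := predT)) ?count_predT ?size_iota; last first.
  by move=> t; rewrite mem_iota /=; lia.
rewrite (eq_in_count (a2 := pred0)) ?count_pred0 ?addn0 //.
by move=> t; rewrite mem_iota /=; lia.
Qed.

Definition vertex_cover e (U : {set 'I_n}) :=
  forall i j, e i j -> (i \in U) || (j \in U).

Lemma cover_packing e v (a : 'I_n -> nat) m :
  simple_graph e ->
  (forall S, induced_odd_cycle e S -> v \in S) ->
  (forall i j, e i j -> m <= a i + a j) ->
  (forall S, induced_odd_cycle e S -> m * uphalf #|S| <= \sum_(i in S) a i) ->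
  exists us : seq {set 'I_n},
    [/\ size us = m, {in us, forall U, vertex_cover e U}
      & forall i, \sum_(U <- us) (i \in U) <= a i].
Proof.
move=> [irr sym] indv ea inda.
pose b i := m - a i.
have bm i : b i <= m by rewrite /b leq_subr.
have eb i j : e i j -> b i + b j <= m by move/ea; rewrite /b; lia.
have oddb s : cycle e s -> odd (size s) -> 2 * (\sum_(x <- s) b x) + m <= m * size s.
  apply: odd_walk_sum => // {}s us cyc indS.
  have odds : odd (size s) by case: indS; rewrite cardsE (card_uniqP us).
  (* At a vertex with [m <= a i] the subtraction truncates and [b i] is 0; the rest of the cycle is
     then an even walk. *)
  case: (classic (exists2 i, i \in s & m <= a i)) => [[i /rot_to[k q def_s] mi] | small].
    rewrite -(size_rot k) -(perm_big _ (introT permPl (perm_rot k s))) /= def_s.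
    rewrite -(size_rot k) -(rot_cycle k) def_s in odds cyc.
    have sq : sorted e q.
      by move: cyc; rewrite /= -cats1 cat_path => /andP[/path_sorted].
    have bi : b i = 0 by apply/eqP; rewrite subn_eq0.
    by have := even_walk_sum eb sq odds; rewrite big_cons bi /=; lia.
  have := inda _ indS; rewrite cardsE (card_uniqP us).
  rewrite (eq_bigl (fun i => i \in s)) => [|i]; last by rewrite inE.
  rewrite -(big_uniq _ us) /=.
  have : \sum_(x <- s) b x + \sum_(x <- s) a x = m * size s.
    rewrite -big_split /= (eq_big_seq (fun=> m)) => [|i si].
      by rewrite big_const_seq count_predT iter_addn_0 mulnC.
    rewrite /b subnK //; apply: contraT => lt_m; case: small; exists i => //; lia.
  have /(congr1 (muln m)) : size s + 1 = 2 * uphalf (size s).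
    by have := odd_double_half (size s); rewrite uphalf_half odds; lia.
  by rewrite mulnDr muln1 mulnCA; lia.
(* Deleting the edges at [v] leaves no induced odd cycle: one would avoid [v] and still be induced
   in [e]. *)
pose e' := [rel x y | [&& e x y, x != v & y != v]].
have [L eL] : bipartite e'.
  apply: even_cycles_bipartite => [x y|s cyc].
    by rewrite /= sym [(x != v) && _]andbC.
  apply/negP => odds.
  have [|x y|S [oddS [S3 [t [ut [tS tE]]]]]] := @odd_walk_induced _ e' s _ _ cyc odds.
  - by move=> x; rewrite /= irr.
  - by rewrite /= sym [(x != v) && _]andbC.
  have Sv x : x \in S -> x != v.
    move=> xS; have nS : next t x \in S by rewrite tS mem_next -tS.
    by have /tE := nS => /(_ _ xS); rewrite eqxx orbT => -[_ /(_ isT)] /and3P[].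
  have : v \in S; last by move/Sv; rewrite eqxx.
  apply: indv; split=> //; split=> //; exists t; split=> //; split=> // x y xS yS.
  by rewrite -tE //= Sv // Sv // !andbT.
have [x [xb xv xe]] : exists x : 'I_n -> nat,
    [/\ forall i, [&& x i <= b i, x i <= b v & b i + b v <= m + x i],
        forall i, e v i -> x i = 0
      & forall i j, i <> v -> j <> v -> e i j ->
          x i + x j <= b v /\ b i + b j + b v <= m + x i + x j].
  apply: (split_weights (L := L)) => // i j eij /eqP iv /eqP jv; apply: eL.
  by rewrite /= eij iv.
(* [T i] is the set of colours of [i]: in each of the two blocks [0, b v), the
   colours of [v], and [b v, m), the vertices of [L] are coloured from below and
   the others from above. *)
pose T i t := if i == v then t < b v else
  if L i then (0 <= t < 0 + x i) || (b v <= t < b v + (b i - x i))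
  else (b v - x i <= t < b v - x i + x i) ||
       (m - (b i - x i) <= t < m - (b i - x i) + (b i - x i)).
pose us := [seq [set i | ~~ T i t] | t <- iota 0 m].
have indep i j t : t < m -> e i j -> ~~ (T i t && T j t).
  have vj k : e v k -> t < b v -> ~~ T k t.
    move=> evk tv; have kv : k != v by apply: contraTneq evk => ->; rewrite irr.
    rewrite /T (negPf kv) xv //; have := eb _ _ evk; case: ifP => _; lia.
  move=> tm eij; case: (eqVneq i v) => [iv | iv].
    by subst i; case: (ltnP t (b v)) (vj _ eij) => [tv /(_ isT)/negPf-> | tv _];
      rewrite ?andbF // {1}/T eqxx ltnNge tv.
  case: (eqVneq j v) => [jv | jv].
    rewrite sym jv in eij; subst j.
    by case: (ltnP t (b v)) (vj _ eij) => [tv /(_ isT)/negPf-> | tv _] //;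
      rewrite andbC {1}/T eqxx ltnNge tv.
  have := eL i j; rewrite /= eij iv jv => /(_ isT).
  have := xe _ _ (elimN eqP iv) (elimN eqP jv) eij.
  have /and3P[? ? ?] := xb i; have /and3P[? ? ?] := xb j.
  rewrite /T (negPf iv) (negPf jv).
  by case: (L i) (L j) => [] [] //= [? ?] _; apply/negP; lia.
have count i : b i <= \sum_(t <- iota 0 m) T i t.
  have /and3P[xi1 xi2 xi3] := xb i; have := bm i; have := bm v => bvm bim.
  rewrite /T; case: (eqVneq i v) => [->|iv].
    by rewrite -{1}(@sum_interval 0 (b v) m) //; apply: leq_sum.
  case: (L i).
    rewrite -[leqLHS](subnKC xi1) -{1}(@sum_interval 0 (x i) m); last lia.
    rewrite -{1}(@sum_interval (b v) (b i - x i) m); last lia.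
    rewrite -big_split; apply: leq_sum => t _ /=; lia.
  rewrite -[leqLHS](subnKC xi1) -{1}(@sum_interval (b v - x i) (x i) m); last lia.
  rewrite -{1}(@sum_interval (m - (b i - x i)) (b i - x i) m); last lia.
  rewrite -big_split; apply: leq_sum => t _ /=; lia.
exists us; split=> [|U /mapP[t t_m ->] i j eij|i].
- by rewrite size_map size_iota.
- rewrite !inE -negb_and; apply: indep => //.
  by move: t_m; rewrite mem_iota.
rewrite big_map (eq_bigr (fun t => ~~ T i t : nat)) => [|t _]; last by rewrite inE.
have : \sum_(t <- iota 0 m) (~~ T i t : nat) + \sum_(t <- iota 0 m) T i t = m.
  rewrite -big_split /= (eq_bigr (fun=> 1)) => [|t _]; last by case: (T i t).
  by rewrite sum1_size size_iota.
have := count i; rewrite /b; lia.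
Qed.

End Packing.

Import GRing.Theory.
Local Open Scope ring_scope.

(** * Associated primes of intersections of powers of monomial primes *)

Section IdealGen.
Variables (K : fieldType) (n : nat).
Notation R := {mpoly K[n]}.
Implicit Types (I S P Q : polyset K n) (f g p q : R).

Lemma ideal_genP S p : ideal_gen S p <->
  exists s : seq (R * R), (forall x, x \in s -> S x.2) /\ p = \sum_(x <- s) x.1 * x.2.
Proof.
split=> [[gs [cs [sz [Sgs ->]]]] | [s [Ss ->]]].
  exists (zip cs gs); split=> [x /(nthP (0, 0))[i] | ].
    rewrite size_zip sz minnn => lt_i <-; rewrite nth_zip //=.
    by apply: Sgs; apply: mem_nth.
  rewrite (big_nth (0, 0)) big_mkord size_zip sz minnn.
  by apply: eq_bigr => i _; rewrite nth_zip.
exists (unzip2 s), (unzip1 s); rewrite !size_map; split=> //; split=> [g /mapP[x xs ->]|].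
  exact: Ss.
rewrite (big_nth (0, 0)) big_mkord; apply: eq_bigr => i _.
by rewrite !(nth_map (0, 0)).
Qed.

Lemma ideal_gen_mem S p : S p -> ideal_gen S p.
Proof.
move=> Sp; apply/ideal_genP; exists [:: (1, p)]; split=> [x|].
  by rewrite inE => /eqP->.
by rewrite big_seq1 mul1r.
Qed.

Lemma ideal_gen_ideal S : is_ideal (ideal_gen S).
Proof.
split; first by apply/ideal_genP; exists [::]; rewrite big_nil.
split=> [a b /ideal_genP[s [Ss ->]] /ideal_genP[t [St ->]] | r a /ideal_genP[s [Ss ->]]].
  apply/ideal_genP; exists (s ++ t); split; last by rewrite big_cat.
  by move=> x; rewrite mem_cat => /orP[/Ss|/St].
apply/ideal_genP; exists [seq (r * x.1, x.2) | x <- s]; split.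
  by move=> x /mapP[y /Ss Sy ->].
by rewrite big_map mulr_sumr; apply: eq_bigr => x _; rewrite mulrA.
Qed.

Lemma ideal_sum I (T : eqType) (s : seq T) (F : T -> R) :
  is_ideal I -> (forall x, x \in s -> I (F x)) -> I (\sum_(x <- s) F x).
Proof.
move=> [I0 [ID _]] IF; rewrite big_seq.
by apply: big_ind => // x y; apply: ID.
Qed.

Lemma ideal_gen_min S I p :
  is_ideal I -> (forall g, S g -> I g) -> ideal_gen S p -> I p.
Proof.
move=> idI SI /ideal_genP[s [Ss ->]]; apply: ideal_sum => // x /Ss/SI.
by case: idI => _ [_]; apply.
Qed.

Lemma ideal_pow1 I p : is_ideal I -> ideal_pow I 1 p <-> I p.
Proof.
move=> idI; split=> [|Ip].
  apply: ideal_gen_min => // g [[|h [|? ?]] [] // _ [sI ->]].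
  by rewrite big_seq1; apply: sI; rewrite inE.
apply: ideal_gen_mem; exists [:: p]; split=> //; rewrite big_seq1; split=> // g.
by rewrite inE => /eqP->.
Qed.

Lemma prime_ideal_ext P Q :
  (forall g, P g <-> Q g) -> prime_ideal P -> prime_ideal Q.
Proof.
move=> PQ [[P0 [PD PM]] [P1 Ppr]]; split; last first.
  by split=> [/PQ//|a b /PQ/Ppr[] /PQ]; [left | right].
split; first by apply/PQ.
by split=> [a b /PQ Pa /PQ Pb | r a /PQ Pa]; [apply/PQ/PD | apply/PQ/PM].
Qed.

Lemma Ass_ext I P Q : (forall g, P g <-> Q g) -> Ass I P -> Ass I Q.
Proof.
move=> PQ [prP [f Pf]]; split; first exact: prime_ideal_ext prP.
by exists f => g; rewrite -PQ.
Qed.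

Lemma prime_ideal_prod P (T : finType) (F : T -> R) :
  prime_ideal P -> (forall x, ~ P (F x)) -> ~ P (\prod_x F x).
Proof.
move=> [_ [P1 Ppr]] PF; apply: (big_ind (fun p => ~ P p)) => // p q Pp Pq.
by case/Ppr.
Qed.

Lemma prime_ideal_exp P p k : prime_ideal P -> ~ P p -> ~ P (p ^+ k).
Proof.
move=> [_ [P1 Ppr]] Pp; elim: k => [|k IHk]; first by rewrite expr0.
by rewrite exprS => /Ppr[].
Qed.

End IdealGen.

(** * Powers of monomial primes, their primariness, and associated primes *)

Section OrderIdeal.
Variables (K : fieldType) (n : nat).
Notation R := {mpoly K[n]}.
Implicit Types (I Q : polyset K n) (A : {set 'I_n}) (f g p q : R) (t : nat).

Definition mdeg_on A (a : 'X_{1..n}) : nat := (\sum_(i in A) a i)%N.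

Lemma mdeg_onD A (a b : 'X_{1..n}) : mdeg_on A (a + b)%MM = (mdeg_on A a + mdeg_on A b)%N.
Proof. by rewrite -big_split; apply: eq_bigr => i _; rewrite mnmDE. Qed.

Lemma mdeg_on1 A i : mdeg_on A U_(i)%MM = (i \in A).
Proof.
rewrite /mdeg_on (eq_bigr (fun j => if j == i then 1%N else 0%N)) => [|j _].
  by rewrite -big_mkcondr big_mkcondl big_pred1_eq; case: (i \in A).
by rewrite mnm1E eq_sym; case: eqP.
Qed.

(* The [t]-th power of the monomial prime generated by the variables in [A]. *)
Definition order_ideal A t : polyset K n :=
  fun p => forall a, a \in msupp p -> (t <= mdeg_on A a)%N.

Lemma order_ideal_ideal A t : is_ideal (order_ideal A t).
Proof.
split; first by move=> a; rewrite msupp0.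
split=> [p q Ip Iq a /msuppD_le | r p Ip a /msuppM_le/allpairsP[[b c] /= [_ /Ip le_c ->]]].
  by rewrite mem_cat => /orP[/Ip|/Iq].
by rewrite mdeg_onD; apply: leq_trans le_c _; apply: leq_addl.
Qed.

Lemma order_idealM A s t p q :
  order_ideal A s p -> order_ideal A t q -> order_ideal A (s + t) (p * q).
Proof.
move=> Ip Iq a /msuppM_le/allpairsP[[b c] /= [/Ip le_b /Iq le_c ->]].
by rewrite mdeg_onD leq_add.
Qed.

Lemma order_idealX A t a : order_ideal A t 'X_[a] <-> (t <= mdeg_on A a)%N.
Proof.
split=> [|le_t b]; first by apply; rewrite msuppX inE.
by rewrite msuppX inE => /eqP->.
Qed.

(** The homogeneous component of degree [d] when the variables in [A] have weight 1 and the others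
    weight 0. *)
Definition deg_part A d p : R :=
  \sum_(a <- msupp p | mdeg_on A a == d) p@_a *: 'X_[a].

Lemma mcoeff_deg_part A d p a :
  (deg_part A d p)@_a = if mdeg_on A a == d then p@_a else 0.
Proof.
rewrite /deg_part raddf_sum /= (eq_bigr (fun b => if b == a then p@_b else 0)); last first.
  by move=> b _; rewrite mcoeffZ mcoeffX; case: eqP => _; rewrite ?mulr1 ?mulr0.
case: (boolP (a \in msupp p)) => [pa | /memN_msupp_eq0 pa].
  rewrite -big_mkcondr big_mkcond (bigD1_seq a) ?msupp_uniq //= eqxx andbT.
  by rewrite big1 ?addr0 // => b /negPf->; rewrite andbF.
by rewrite pa if_same big1 // => b _; case: eqP => [->|].
Qed.

(* The lowest parts of [f] and [g] multiply to the lowest part of [g * f],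
   which is nonzero as polynomials form a domain. *)
Lemma order_ideal_primary A t f g :
  order_ideal A t (g * f) -> ~ order_ideal A t f -> order_ideal A 1 g.
Proof.
move=> Igf nIf; apply: NNPP => nIg.
have lowest s p : ~ order_ideal A s p -> exists d, [/\ (d < s)%N,
    order_ideal A d p & ~ order_ideal A d.+1 p].
  elim: s => [[] // | s IHs nIs].
  by case: (classic (order_ideal A s p)) => [Is | /IHs[d [/ltnW lt_d]]];
    [exists s | exists d].
have split_low d p : order_ideal A d p -> order_ideal A d.+1 (p - deg_part A d p).
  move=> Id a; rewrite mcoeff_msupp mcoeffB mcoeff_deg_part.
  case: (eqVneq (mdeg_on A a) d) => [_|nd]; first by rewrite subrr eqxx.
  by rewrite subr0 -mcoeff_msupp => /Id; rewrite leq_eqVlt eq_sym (negPf nd).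
have low_neq0 d p : order_ideal A d p -> ~ order_ideal A d.+1 p -> deg_part A d p != 0.
  by move=> /split_low + nI; apply: contraPneq => ->; rewrite subr0.
have low_supp d p a : a \in msupp (deg_part A d p) -> mdeg_on A a = d.
  by rewrite mcoeff_msupp mcoeff_deg_part; case: (eqVneq (mdeg_on A a) d) => //; rewrite eqxx.
have [d [lt_d If nIf']] := lowest _ _ nIf.
have [d0 [/ltnSE + Ig nIg']] := lowest _ _ nIg; rewrite leqn0 => /eqP d00.
subst d0; have [_ [ID IM]] := order_ideal_ideal A d.+1.
pose f0 := deg_part A d f; pose g0 := deg_part A 0 g.
have low : order_ideal A d.+1 (g0 * f0).
  have -> : g0 * f0 = g * f + (-1) * (g * (f - f0)) + (-1) * (f0 * (g - g0)).
    by ring.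
  apply: (ID); first apply: (ID); rewrite -/f0.
  - by move=> a /Igf; apply: leq_trans.
  - by do 2!apply: (IM); apply: split_low.
  apply: IM; rewrite mulrC -add1n; apply: order_idealM; first exact: split_low.
  by move=> a /low_supp->.
have /negP[] : g0 * f0 != 0 by rewrite mulf_neq0 // low_neq0.
rewrite -msupp_eq0; case def_s: (msupp _) => [//|a s].
have aS : a \in msupp (g0 * f0) by rewrite def_s inE eqxx.
have /allpairsP[[b c] /= [/low_supp b0 /low_supp cd def_a]] := msuppM_le aS.
by have := low _ aS; rewrite def_a mdeg_onD b0 cd ltnn.
Qed.

Lemma order_ideal_prime A : prime_ideal (order_ideal A 1).
Proof.
split; first exact: order_ideal_ideal.
split=> [|a b Iab].
  by rewrite -mpolyX0 order_idealX /mdeg_on big1 // => i _; rewrite mnm0E.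
case: (classic (order_ideal A 1 b)); first by right.
by left; apply: order_ideal_primary Iab _.
Qed.

Lemma order_ideal1_gen A g : order_ideal A 1 g <->
  ideal_gen (fun h => exists2 i, i \in A & h = 'X_i) g.
Proof.
split=> [Ig|].
  have [_ [_ IM]] := ideal_gen_ideal (fun h : R => exists2 i, i \in A & h = 'X_i).
  rewrite [g]mpolyE; apply: ideal_sum; first exact: ideal_gen_ideal.
  move=> a /Ig; rewrite lt0n sum_nat_eq0 => /forallPn[i].
  rewrite negb_imply => /andP[iA ai].
  have -> : a = ((a - U_(i)) + U_(i))%MM by rewrite submK // lep1mP.
  rewrite mpolyXD -mul_mpolyC mulrA; apply/IM/ideal_gen_mem.
  by exists i.
apply: ideal_gen_min => [|h [i iA ->]]; first exact: order_ideal_ideal.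
by rewrite order_idealX mdeg_on1 iA.
Qed.

Lemma order_ideal1_inj A B :
  (forall g, order_ideal A 1 g <-> order_ideal B 1 g) -> A = B.
Proof.
move=> AB; apply/setP => i; apply/idP/idP => iA.
  by have := AB 'X_i; rewrite !order_idealX !mdeg_on1 iA !lt0b => -[/(_ isT)].
by have := AB 'X_i; rewrite !order_idealX !mdeg_on1 iA !lt0b => -[_ /(_ isT)].
Qed.

Lemma order_ideal_monomial_prime A : monomial_prime (order_ideal A 1).
Proof.
by split; [apply: order_ideal_prime | exists A => g; apply: order_ideal1_gen].
Qed.

(** If [Q] matched no [A] in [F], each such [A] would have a multiplier [h] outside [Q] moving [f]
    into its ideal; the product of these finitely many multipliers sends [f] into [I], so it lies in
    [Q], against primality. *)
Lemma Ass_cap_order_ideal I (F : {set 'I_n} -> Prop) (t : {set 'I_n} -> nat) Q :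
  (forall f, I f <-> forall A, F A -> order_ideal A (t A) f) ->
  Ass I Q -> exists2 A, F A & forall g, Q g <-> order_ideal A 1 g.
Proof.
move=> IE [prQ [f Qf]]; apply: NNPP => noA.
have /fin_all_exists[h hP] A : exists h : R,
    ~ Q h /\ (F A -> order_ideal A (t A) (h * f)).
  case: (classic (F A -> order_ideal A (t A) f)) => [FAf | nFAf].
    by exists 1; rewrite mul1r; split=> //; case: prQ => _ [].
  have [FA nAf] := imply_to_and _ _ nFAf.
  (* Primariness puts [Q] inside the prime of [A]; if [Q] held all variables of [A], the two would
     agree. *)
  have [i [iA nQi]] : exists i, i \in A /\ ~ Q 'X_i.
    apply: NNPP => allQ; apply: noA; exists A => // g; split=> [/Qf/IE/(_ _ FA) Agf|].
      exact: order_ideal_primary Agf nAf.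
    move/order_ideal1_gen; apply: ideal_gen_min; first by case: prQ.
    move=> _ [i iA ->]; apply: NNPP => nQi; apply: allQ.
    by exists i.
  exists ('X_i ^+ t A); split=> [|_]; first exact: prime_ideal_exp.
  have [_ [_ IM]] := order_ideal_ideal A (t A); rewrite mulrC; apply: IM.
  elim: (t A) => [|k IHk] //; rewrite exprS -add1n.
  by apply: order_idealM IHk; rewrite order_idealX mdeg_on1 iA.
apply: (prime_ideal_prod prQ (fun A => (hP A).1)); apply/Qf/IE => A FA.
rewrite (bigD1 A) //= mulrAC mulrC.
by have [_ [_ IM]] := order_ideal_ideal A (t A); apply/IM/(hP A).2.
Qed.

Lemma order_ideal_Ass I A a :
  is_ideal I -> (forall p, I p -> order_ideal A (mdeg_on A a).+1 p) ->
  (forall i, i \in A -> I 'X_[U_(i) + a]) -> Ass I (order_ideal A 1).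
Proof.
move=> [I0 [ID IM]] IA Ia; split; first exact: order_ideal_prime.
exists 'X_[a] => g; split=> [/order_ideal1_gen|/IA Iga]; last first.
  by apply: order_ideal_primary Iga _; rewrite order_idealX ltnn.
apply: (@ideal_gen_min _ _ _ (fun g => I (g * 'X_[a]))) => [|_ [i iA ->]].
  split; first by rewrite mul0r.
  by split=> [p q Ip Iq|r p Ip]; rewrite ?mulrDl -?mulrA; [apply: ID|apply: IM].
by rewrite -mpolyXD; apply: Ia.
Qed.

End OrderIdeal.

(** * Powers of cover ideals *)

Section CoverIdeal.
Variables (K : fieldType) (n : nat) (e : rel 'I_n).
Notation R := {mpoly K[n]}.
Hypothesis simple_e : simple_graph e.
Implicit Types (A S U : {set 'I_n}) (Q : polyset K n) (f g p q : R) (m : nat).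

Local Notation J := (@cover_ideal K n e).

Lemma cover_idealP f : J f <-> forall i j, e i j -> order_ideal [set i; j] 1 f.
Proof.
split=> Jf i j /Jf; [rewrite order_ideal1_gen | rewrite order_ideal1_gen];
  apply: ideal_gen_min => [|h]; try exact: ideal_gen_ideal.
  by case=> ->; apply: ideal_gen_mem; [exists i | exists j]; rewrite // !inE eqxx ?orbT.
by case=> k; rewrite !inE => /orP[]/eqP-> ->; apply: ideal_gen_mem; [left | right].
Qed.

Lemma cover_ideal_ideal : is_ideal J.
Proof.
split; first by apply/cover_idealP => i j _; case: (order_ideal_ideal K [set i; j] 1).
split=> [a b /cover_idealP Ja /cover_idealP Jb|r a /cover_idealP Ja];
  apply/cover_idealP => i j eij; case: (order_ideal_ideal K [set i; j] 1) => _ [ID IM].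
  by apply: ID; [apply: Ja | apply: Jb].
by apply/IM/Ja.
Qed.

Lemma edge_neq i j : e i j -> i != j.
Proof. by case: simple_e => irr _; apply: contraTneq => ->; rewrite irr. Qed.

Lemma mdeg_on_edge i j (a : 'X_{1..n}) : e i j -> mdeg_on [set i; j] a = (a i + a j)%N.
Proof. by move=> /edge_neq ij; rewrite /mdeg_on big_setU1 ?inE // big_set1. Qed.

Lemma cover_ideal_vertex_cover U :
  vertex_cover e U -> J 'X_[[multinom (i \in U : nat) | i < n]].
Proof.
move=> cU; apply/cover_idealP => i j eij; rewrite order_idealX mdeg_on_edge //.
by rewrite !mnmE; have := cU _ _ eij; case: (i \in U) (j \in U) => [] [].
Qed.

(** Summing the edge inequalities around the cycle counts each vertex twice; halving the odd number
    of edges rounds up. *)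
Lemma induced_odd_cycle_sum S (c : 'I_n -> nat) :
  (forall i j, e i j -> 1 <= c i + c j)%N -> induced_odd_cycle e S ->
  (uphalf #|S| <= \sum_(i in S) c i)%N.
Proof.
move=> ec [oddS [_ [s [us [Ss es]]]]].
have next_inj : injective (next s) by apply: can_inj (prev_next us).
have : (\sum_(i in S) 1 <= \sum_(i in S) (c i + c (next s i)))%N.
  apply: leq_sum => i iS; apply/ec/es; rewrite ?eqxx //.
  by rewrite Ss mem_next -Ss.
rewrite sum1_card big_split /=.
have -> : (\sum_(i in S) c (next s i) = \sum_(i in S) c i)%N.
  rewrite [RHS](reindex_inj next_inj); apply: eq_bigl => i.
  by rewrite !Ss mem_next.
move: #|S| (\sum_(i in S) c i)%N oddS => k w oddk.
by have := odd_double_half k; rewrite uphalf_half oddk; lia.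
Qed.

(** In both cases [uphalf #|A|] is the least number of vertices of [A] in a vertex cover, which lets
    edges and odd cycles be treated together. *)
Definition critical A :=
  (exists i j, e i j /\ A = [set i; j]) \/ induced_odd_cycle e A.

Lemma cover_ideal_order A p : critical A -> J p -> order_ideal A (uphalf #|A|) p.
Proof.
move=> [[i [j [eij ->]]] | indA] /cover_idealP Jp.
  by rewrite cards2 edge_neq //; apply: Jp.
move=> a pa; apply: induced_odd_cycle_sum indA => i j eij.
by rewrite -mdeg_on_edge //; apply: Jp.
Qed.

Lemma pow_cover_ideal_order A m p :
  critical A -> ideal_pow J m p -> order_ideal A (m * uphalf #|A|) p.
Proof.
move=> cA; apply: ideal_gen_min; first exact: order_ideal_ideal.
move=> _ [s [<- [Js ->]]]; elim: s Js => [|g s IHs] Js.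
  by rewrite big_nil => a _; rewrite mul0n.
rewrite big_cons mulSn; apply: order_idealM.
  by apply: cover_ideal_order => //; apply: Js; rewrite mem_head.
by apply: IHs => h hs; apply: Js; rewrite inE hs orbT.
Qed.

Lemma pow_cover_ideal_covers (us : seq {set 'I_n}) (a : 'X_{1..n}) :
  {in us, forall U, vertex_cover e U} ->
  (forall i, \sum_(U <- us) (i \in U) <= a i)%N -> ideal_pow J (size us) 'X_[a].
Proof.
move=> cus us_a; pose w U : 'X_{1..n} := [multinom (i \in U : nat) | i < n].
have -> : a = ((a - \sum_(U <- us) w U) + \sum_(U <- us) w U)%MM.
  rewrite submK //; apply/mnm_lepP => i; rewrite mnm_sumE.
  by apply: leq_trans (us_a i); apply: leq_sum => U _; rewrite mnmE.
have [_ [_ IM]] := ideal_gen_ideal (fun p => exists s : seq R,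
  size s = size us /\ (forall g, g \in s -> J g) /\ p = \prod_(g <- s) g).
rewrite mpolyXD; apply/IM/ideal_gen_mem; exists [seq 'X_[w U] | U <- us].
rewrite size_map; split=> //; split=> [g /mapP[U /cus cU ->]|].
  exact: cover_ideal_vertex_cover.
by rewrite big_map mprodXE.
Qed.

(** All ideals involved are monomial, so the converse is tested on each exponent of [f]; there the
    order conditions are the hypotheses of [cover_packing]. *)
Lemma pow_cover_idealE v m f : (forall S, induced_odd_cycle e S -> v \in S) ->
  ideal_pow J m f <-> forall A, critical A -> order_ideal A (m * uphalf #|A|) f.
Proof.
move=> ev; split=> [Jf A cA|If]; first exact: pow_cover_ideal_order.
rewrite [f]mpolyE; apply: ideal_sum => [|a fa]; first exact: ideal_gen_ideal.
have [_ [_ IM]] := ideal_gen_ideal (fun p => exists s : seq R,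
  size s = m /\ (forall g, g \in s -> J g) /\ p = \prod_(g <- s) g).
rewrite -mul_mpolyC; apply: IM.
have [i j eij|S indS|us [<- cus us_a]] := @cover_packing _ e v a m simple_e ev.
- have := If [set i; j] _ a fa.
  rewrite mdeg_on_edge // cards2 edge_neq //= muln1; apply.
  by left; exists i, j.
- by apply: If fa; right.
exact: pow_cover_ideal_covers.
Qed.

Lemma Ass_edge i j m : e i j -> (0 < m)%N -> Ass (ideal_pow J m) (order_ideal [set i; j] 1).
Proof.
move=> eij m0; have ij := edge_neq eij.
have cover_i k l : e k l -> vertex_cover e (~: [set k]).
  move=> _ x y; rewrite !inE -negb_and; apply: contraTN => /andP[/eqP-> /eqP->].
  by case: simple_e => ->.
have cA : critical [set i; j] by left; exists i, j.
pose a : 'X_{1..n} :=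
  [multinom if k == i then m.-1 else if k == j then 0%N else m | k < n].
have deg_a : (mdeg_on [set i; j] a).+1 = (m * uphalf #|[set i; j]|)%N.
  by rewrite mdeg_on_edge // !mnmE !eqxx [j == i]eq_sym (negPf ij) cards2 ij /= muln1 addn0 prednK.
apply: (order_ideal_Ass (a := a)) => [|p|k]; first exact: ideal_gen_ideal.
  by rewrite deg_a; apply: pow_cover_ideal_order.
rewrite !inE => ijk.
(* With an extra ['X_i] there is room for [m] covers missing [j]; with an extra ['X_j], for one
   cover missing [i] and [m - 1] missing [j]. *)
pose us := (~: [set if k == i then j else i]) :: nseq m.-1 (~: [set j]).
have -> : m = size us by rewrite /= size_nseq prednK.
apply: pow_cover_ideal_covers => [U|x].
  rewrite inE mem_nseq => /predU1P[->|/andP[_ /eqP->]]; last first.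
    by apply: cover_i; case: simple_e => _ ->; apply: eij.
  by case: ifP => _; [case: simple_e => _ sym; rewrite sym in eij|]; apply: cover_i eij.
rewrite /us big_cons big_nseq iter_addn_0 mnmDE mnm1E mnmE !inE.
case/orP: ijk => /eqP->; rewrite ?eqxx ?[j == i]eq_sym ?(negPf ij);
  rewrite ![_ == x]eq_sym; have [xi|xi] := eqVneq x i; have [xj|xj] := eqVneq x j => /=.
all: try by rewrite -xi -xj eqxx in ij.
all: try lia.
Qed.

(** Parities alternate along the cycle from [i]; only the closing edge joins two even positions.
    Taking the even positions, or the odd ones together with [i], and everything outside [S] gives
    covers that overlap on [S] only at [i]. *)
Lemma induced_odd_cycle_covers S i : induced_odd_cycle e S -> i \in S ->
  exists U0 U1, [/\ vertex_cover e U0, vertex_cover e U1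
    & forall j, ((j \in U0) + (j \in U1) <= if j \in S then (i == j).+1 else 2)%N].
Proof.
move=> [oddS [_ [s0 [us0 [S0 es0]]]]] iS; have [_ sym] := simple_e.
have [r s def_s] : rot_to_spec s0 i by apply: rot_to; rewrite -S0.
have us : uniq (i :: s) by rewrite -def_s rot_uniq.
have Ss x : (x \in S) = (x \in i :: s) by rewrite -def_s mem_rot.
have evs : ~~ odd (size s).
  by move: oddS; rewrite (eq_card Ss) (card_uniqP us).
pose c x := odd (index x (i :: s)).
have ci : c i = false by rewrite /c /= eqxx.
have cnext x : x \in S -> c (next (i :: s) x) = ~~ c x \/ next (i :: s) x = i /\ ~~ c x.
  rewrite Ss next_nth => xs; rewrite xs.
  have := xs; rewrite -index_mem /= ltnS leq_eqVlt => /orP[/eqP lastx | lt_s].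
    by right; rewrite nth_default /c /= lastx.
  left; rewrite /c -[nth i s _]/(nth i (i :: s) (index x (i :: s)).+1).
  by rewrite index_uniq.
have edge x y : x \in S -> y \in S -> e x y ->
    y = next (i :: s) x \/ x = next (i :: s) y.
  move=> xS yS /(es0 _ _ xS yS); rewrite -!(next_rot r us0) def_s.
  by case/orP=> /eqP; [left | right].
exists [set x | (x \notin S) || ~~ c x], [set x | [|| x \notin S, c x | x == i]].
split=> [x y exy | x y exy | j].
- rewrite !inE; have [xS|//] := boolP (x \in S).
  have [yS|] := boolP (y \in S); rewrite ?orbT //= -negb_and.
  case: (edge x y) => // ->; [have := cnext _ xS | have := cnext _ yS];
    by case=> [->|[-> _]]; rewrite ?ci ?andbN ?andNb ?andbF.
- rewrite !inE; have [xS|//] := boolP (x \in S).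
  have [yS|] := boolP (y \in S); rewrite ?orbT //=.
  case: (edge x y) => // ->; [have := cnext _ xS | have := cnext _ yS];
    by case=> [->|[-> _]]; rewrite ?eqxx ?orbT //; case: (c _); rewrite ?orbT.
rewrite !inE; case: (boolP (j \in S)) => _ //=; rewrite [i == j]eq_sym.
by case: (c j) (j == i) => [] [].
Qed.

Lemma Ass_induced_odd_cycle S m : induced_odd_cycle e S -> (2 <= m)%N ->
  Ass (ideal_pow J m) (order_ideal S 1).
Proof.
move=> indS m2; have cS : critical S by right.
have deg_cover U : vertex_cover e U -> (uphalf #|S| <= \sum_(i in S) (i \in U))%N.
  move=> cU; apply: induced_odd_cycle_sum indS => i j /cU.
  by case: (i \in U) (j \in U) => [] [].
have sizeS : #|S|.+1 = (uphalf #|S| + uphalf #|S|)%N.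
  case: indS => oddS _; move: #|S| oddS => k oddk.
  by have := odd_double_half k; rewrite uphalf_half oddk; lia.
(* The two covers built from a vertex of [S] have total size at most [#|S| + 1] on [S], twice the
   lower bound, so each attains it. *)
have [T cT sumT] : exists2 T, vertex_cover e T & (\sum_(i in S) (i \in T) = uphalf #|S|)%N.
  have /card_gt0P[i iS] : (0 < #|S|)%N by case: indS => _ [/ltnW/ltnW].
  have [U0 [U1 [c0 c1 U01]]] := induced_odd_cycle_covers indS iS.
  exists U0 => //; have le0 := deg_cover _ c0; have le1 := deg_cover _ c1.
  suff : (\sum_(j in S) (j \in U0) + \sum_(j in S) (j \in U1) <= #|S|.+1)%N by lia.
  apply: (@leq_trans (\sum_(j in S) (1 + U_(i)%MM j))%N).
    rewrite -big_split; apply: leq_sum => j jS; have := U01 j.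
    by rewrite jS mnm1E add1n.
  by rewrite big_split /= sum1_card -/(mdeg_on S _) mdeg_on1 iS addn1.
(* On [S], every variable is taken once and [T] is taken [m - 2] times: since [#|S|] is
   [2 * uphalf #|S| - 1], the order is one short of [m * uphalf #|S|]. One more ['X_i] makes room
   for [U0] and [U1]. *)
pose a : 'X_{1..n} :=
  [multinom if j \in S then (1 + (m - 2) * (j \in T))%N else m | j < n].
have deg_a : (mdeg_on S a).+1 = (m * uphalf #|S|)%N.
  rewrite /mdeg_on (eq_bigr (fun j => 1 + (m - 2) * (j \in T)))%N => [|j jS]; last first.
    by rewrite mnmE jS.
  rewrite big_split /= sum1_card -big_distrr /= sumT -addSn sizeS.
  by rewrite -[in RHS](subnKC m2) mulnDl; lia.
apply: (order_ideal_Ass (a := a)) => [|p|i iS]; first exact: ideal_gen_ideal.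
  by rewrite deg_a; apply: pow_cover_ideal_order.
have [U0 [U1 [c0 c1 U01]]] := induced_odd_cycle_covers indS iS.
have size_us : size [:: U0, U1 & nseq (m - 2) T] = m by rewrite /= size_nseq; lia.
rewrite -[in ideal_pow _ _]size_us; apply: pow_cover_ideal_covers => [U|j].
  by rewrite !inE mem_nseq => /or3P[/eqP->|/eqP->|/andP[_ /eqP->]].
rewrite !big_cons big_nseq iter_addn_0 mnmDE mnm1E mnmE.
have := U01 j; case: (j \in S); last by case: (j \in T); lia.
by rewrite mulnC; case: (i == j); lia.
Qed.

(** [J] is by definition the intersection of the primes of the edges, whatever odd cycles occur. *)
Lemma Ass_pow1 Q : Ass (ideal_pow J 1) Q ->
  exists i j, e i j /\ forall g, Q g <-> order_ideal [set i; j] 1 g.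
Proof.
move=> /(@Ass_cap_order_ideal _ _ _
  (fun A => exists i j, e i j /\ A = [set i; j]) (fun=> 1%N)) [f|].
  rewrite ideal_pow1; last exact: cover_ideal_ideal.
  rewrite cover_idealP; split=> [Jf _ [i [j [/Jf ? ->]]] // | Jf i j eij].
  by apply: Jf; exists i, j.
by move=> _ [i [j [eij ->]]] QA; exists i, j.
Qed.

End CoverIdeal.

(** * Nearly copersistence of cover ideals *)

Theorem theorem4p1 (K : fieldType) (n : nat) (e : rel 'I_n) :
  (0 < n)%N -> simple_graph e -> connected_graph e ->
  (nearly_copersistent (@cover_ideal K n e) <-> bipartite e \/ almost_bipartite e).
Proof.
move=> n0 simple_e _; have [irr sym] := simple_e; split=> [[s [P [s0 [_ [low _]]]]] | cases].
  (* The prime of an induced odd cycle is associated to the second power but not to the first, as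
     edges have only two vertices; so it is the exceptional prime [P]. *)
  have cycleP S : induced_odd_cycle e S -> forall g, order_ideal S 1 g <-> P g.
    move=> indS; have AssS := Ass_induced_odd_cycle K simple_e indS (leqnn 2).
    case: (low 1%N s0 _ AssS) => // /Ass_pow1[i [j [_ /order_ideal1_inj defS]]].
    by case: indS => _ []; rewrite defS cards2; case: (i != j).
  case: (classic (exists S, induced_odd_cycle e S)) => [[S indS] | noS].
    right; exists S; split=> // S' indS'; apply: (@order_ideal1_inj K) => g.
    by rewrite (cycleP _ indS) (cycleP _ indS').
  left; apply: even_cycles_bipartite => // t cyc; apply/negP => oddt.
  exact/noS/(odd_walk_induced irr sym cyc oddt).
have [v [C [ev eC]]] : exists (v : 'I_n) (C : {set 'I_n}),
    (forall S, induced_odd_cycle e S -> v \in S) /\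
    (forall S, induced_odd_cycle e S -> S = C).
  case: cases => [bip | [C [indC uniqC]]].
    (* In the bipartite case both conditions are vacuous, so any vertex and the empty set serve. *)
    by exists (Ordinal n0), set0; split=> S /(bipartite_no_induced_odd_cycle bip).
  have /card_gt0P[v vC] : (0 < #|C|)%N by case: indC => _ [/ltnW/ltnW].
  by exists v, C; split=> S /uniqC <-.
(* Primes of edges are associated to all positive powers, and that of an odd cycle [C] from the
   second power on, so an exception can occur only at [m = 1]. *)
exists 1%N, (order_ideal C 1); split=> //; split; first exact: order_ideal_monomial_prime.
have AssE m Q : Ass (ideal_pow (@cover_ideal K n e) m) Q ->
    (exists i j, e i j /\ forall g, Q g <-> order_ideal [set i; j] 1 g) \/
    induced_odd_cycle e C /\ forall g, Q g <-> order_ideal C 1 g.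
  move=> /(Ass_cap_order_ideal (fun f => pow_cover_idealE simple_e m f ev)).
  move=> [A [[i [j [eij ->]]] QA|indA QA]]; first by left; exists i, j.
  by right; rewrite -(eC _ indA).
have edge_case m Q i j : e i j -> (0 < m)%N ->
    (forall g, Q g <-> order_ideal [set i; j] 1 g) ->
    Ass (ideal_pow (@cover_ideal K n e) m) Q.
  move=> eij m0 QA; apply: (Ass_ext (fun g => iff_sym (QA g))).
  exact: Ass_edge.
split=> m m1 Q /AssE[[i [j [eij QA]]]|[indC QC]].
- by left; apply: edge_case QA => //; case/andP: m1.
- by right.
- by apply: edge_case QA => //; apply: ltnW.
apply: (Ass_ext (fun g => iff_sym (QC g))).
exact: Ass_induced_odd_cycle.
Qed.
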